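(* Let $A\in\mathbb{R}^{m\times n}$, $b\in\mathbb{R}^m$. Let $\phi:[0,\infty)\to\mathbb{R}$ be lower semi-continuous and increasing on $[0,\infty)$ with $\phi(0)=0$, and suppose additionally that $$\phi(s)\ge\phi(t)-\phi(|s-t|)\qquad\forall s,t\ge0.$$ Let $x^*\in\mathbb{R}^n$ be such that $Ax^*=b$. Assume that the local null space property LNSP($r$,$\phi$) holds for the system $Ax=b$ at $x^*$ for some integer $r$ with $0\le r\le\|x^*\|_0$ and $r\le n-1$. Then $x^*$ is a strictly local minimizer of the problem $$\min_{x\in\mathbb{R}^n}\Big\{\sum_{i=r+1}^n\phi(|x|_{[i]}):\ Ax-b=0\Big\}$$ with such $\phi$ and $r$.
   Context: $|x|_{[i]}$ denotes the $i$th largest element of $\{|x_1|,\ldots,|x_n|\}$ (counted with multiplicity); $\|x\|_0$ is the number of nonzero entries; $\mathcal N(A)$ is the null space of $A$; $\|\cdot\|$ is the Euclidean norm. ''Increasing'' is meant in the weak sense. For $x\in\mathbb{R}^n$ and $j\in\{1,\ldots,n\}$ let $\mathcal I_0(x)=\{i:x_i=0\}$, $\mathcal I_j^{=}(x)=\{i:|x_i|=|x|_{[j]}\}$, $\mathcal I_j^{<+}(x)=\{i:0<|x_i|<|x|_{[j]}\}$. Definition (local null space property). LNSP($r$,$\phi$) holds for the system $Ax=b$ at a solution $x^*$ with $\|x^*\|_0\ge r$ if there exists $\epsilon>0$ such that $$\sum_{i\in\mathcal I_0(x^* )}\phi(|h_i|)-\max_{J\in\mathcal J}\sum_{i\in J\cup\mathcal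 I_{r+1}^{<+}(x^* )}\phi(|h_i|)>0$$ for all $h\in\mathcal N(A)$ with $0<\|h\|<\epsilon$, where $$\mathcal J=\{J\subseteq\mathcal I_{r+1}^{=}(x^* ):\ |J|=\|x^*\|_0-r-|\mathcal I_{r+1}^{<+}(x^* )|\}.$$ Strictly local minimizer: a feasible point whose objective value is strictly smaller than that of every other feasible point in some neighborhood. *)

(* Defs.v *)
From HB Require Import structures.
From mathcomp Require Import all_boot all_order all_algebra.
From mathcomp Require Import all_classical all_reals all_analysis.

Set Implicit Arguments.
Unset Strict Implicit.
Unset Printing Implicit Defensive.

Import Order.TTheory GRing.Theory Num.Theory.
Import numFieldNormedType.Exports.

Local Open Scope ring_scope.

Section Vectors.
Context {R : realType} {n : nat}.
Implicit Types (x h : 'cV[R]_n) (phi : R -> R).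

(* [absrank x i] is |x|_[i]: the index is 1-based, and only 1 <= i <= n is
   meaningful. *)
Definition absrank x (i : nat) : R :=
  nth 0 (sort >=%R [seq `|x j 0| | j <- enum 'I_n]) i.-1.

Definition l0norm x : nat := #|[set j : 'I_n | x j 0 != 0]%SET|.

(* The library norm on matrices is the maximum norm. *)
Definition enorm x : R := Num.sqrt (\sum_(j < n) x j 0 ^+ 2).

Definition idx_zero x : {set 'I_n} := [set i | x i 0 == 0]%SET.

Definition idx_eq x (j : nat) : {set 'I_n} :=
  [set i | `|x i 0| == absrank x j]%SET.

Definition idx_ltpos x (j : nat) : {set 'I_n} :=
  [set i | 0 < `|x i 0| < absrank x j]%SET.

(* The family of index sets J of LNSP; its cardinality condition is written
   additively because subtraction on nat is truncated. *)
Definition lnsp_family x (r : nat) : {set {set 'I_n}} :=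
  [set J : {set 'I_n} | (J \subset idx_eq x r.+1) &&
     (#|J| + r + #|idx_ltpos x r.+1| == l0norm x)%N]%SET.

(* The supremum ranges over a finite family, nonempty when r <= l0norm x and
   r < n, so it is a maximum. *)
Definition lnsp {m : nat} (A : 'M[R]_(m, n)) phi (r : nat) x : Prop :=
  exists2 e : R, 0 < e &
    forall h, A *m h = 0 -> 0 < enorm h < e ->
      \sum_(i in idx_zero x) phi `|h i 0|
      - sup [set (\sum_(i in (J :|: idx_ltpos x r.+1)%SET) phi `|h i 0|)
              | J in [set` lnsp_family x r]]%classic > 0.

Definition trimmed_obj phi (r : nat) x : R :=
  \sum_(r.+1 <= i < n.+1) phi (absrank x i).

(* The topology of 'cV[R]_n is the product topology, i.e. the Euclidean one. *)
Definition strict_local_minimizer (f : 'cV[R]_n -> R)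
    (feasible : 'cV[R]_n -> Prop) x : Prop :=
  feasible x /\
  \forall y \near x, feasible y -> y != x -> f x < f y.

End Vectors.

(* Main.v *)
Require Import Defs.
From HB Require Import structures.
From mathcomp Require Import all_boot all_order all_algebra.
From mathcomp Require Import all_classical all_reals all_analysis.
From mathcomp Require Import zify.

(** The trimmed objective is a minimum of ordinary separable sums: over all
    index sets T with n - r elements, the sum of phi |x_i| over T is smallest
    when T collects n - r smallest entries of x. Call such a T a bottom set
    of x. [exists_bottom_set] says that the objective is attained on a bottom
    set, and [trimmed_obj_le_sum] that it is a lower bound for every other T.

    Let y = xs + h be feasible and close to xs, and let T be a bottom set of y.
    A small perturbation cannot reverse a strict inequality between moduli, so
    T is also a bottom set of xs ([near_bottom_set]). A bottom set of xs
    contains all zeros of xs because r <= ||xs||_0, and removing these zeros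
    leaves exactly one of the sets J :|: I^{<+} of the null space property
    ([lnsp_family_bottom_set]); write I0 for the zeros. The triangle-type
    inequality for phi, applied on T \ I0, then gives

      f(y) = sum_{I0} phi |h_i| + sum_{T \ I0} phi |y_i|
          >= sum_{I0} phi |h_i| - sum_{T \ I0} phi |h_i|
             + sum_{T \ I0} phi |xs_i|,

    where the first difference is positive by the null space property, and the
    last sum equals the sum over T since phi 0 = 0, hence is at least f(xs). *)

Set Implicit Arguments.
Unset Strict Implicit.
Unset Printing Implicit Defensive.

Import Order.TTheory GRing.Theory Num.Theory.
Import numFieldNormedType.Exports.

Local Open Scope ring_scope.

Section TrimmedSums.
Context {R : realType} {n : nat}.
Implicit Types (x y h : 'cV[R]_n) (phi : R -> R) (r : nat) (T : {set 'I_n}).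

(** Ties at the threshold |x|_{[r+1]} make such a set non-unique; membership is
    constrained only by weak inequalities so that every choice qualifies. *)
Definition is_bottom_set x r T : Prop :=
  [/\ #|T| = (n - r)%N,
      forall i, i \in T -> `|x i 0| <= absrank x r.+1 &
      forall i, i \notin T -> absrank x r.+1 <= `|x i 0|].

(** The entries past position r in a decreasing enumeration of the indices form
    such a set. It depends on the order of the moduli only, so one T serves
    every phi. *)
Lemma exists_bottom_set x r : (r < n)%N ->
  exists2 T, is_bottom_set x r T &
    forall phi, trimmed_obj phi r x = \sum_(i in T) phi `|x i 0|.
Proof.
move=> rn; set a := fun j : 'I_n => `|x j 0|.
(* Sorting the indices instead of the moduli keeps track of which index holds
   each rank. *)
pose s := sort (relpre a >=%R) (enum 'I_n).
have ps : perm_eq s (enum 'I_n) by rewrite /s perm_sort.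
have us : uniq s by rewrite (perm_uniq ps) enum_uniq.
have ms i : i \in s by rewrite (perm_mem ps) mem_enum.
have szs : size s = n by rewrite (perm_size ps) size_enum_ord.
pose i0 := Ordinal rn.
have rankE k : (k < n)%N -> absrank x k.+1 = a (nth i0 s k).
  by move=> kn; rewrite /absrank sort_map (nth_map i0) ?szs.
have s_sorted : sorted (relpre a >=%R) s.
  by apply: sort_sorted => i j; exact: ge_total.
have anti k l : (k <= l)%N -> (l < n)%N -> a (nth i0 s l) <= a (nth i0 s k).
  move=> kl ln; have := @sorted_leq_nth _ (relpre a >=%R) _ _ i0 s s_sorted k l.
  rewrite !inE szs; apply => //; last exact: leq_ltn_trans ln.
  - by move=> u v w /= uv vw; exact: le_trans vw uv.
  - by move=> u /=.
have memT i : (i \in [set j in drop r s]%SET) = (r <= index i s)%N.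
  rewrite inE -[in RHS](cat_take_drop r s) index_cat.
  have szt : size (take r s) = r by rewrite size_take szs rn.
  have := ms i; rewrite -{1}(cat_take_drop r s) mem_cat.
  have : uniq (take r s ++ drop r s) by rewrite cat_take_drop.
  rewrite cat_uniq => /and3P[_ /hasPn disj _].
  case: ifP => [it _|_ /= ->]; last by rewrite szt leq_addr.
  rewrite leqNgt -[X in (_ < X)%N]szt index_mem it /=.
  by apply/negP => /disj /=; rewrite it.
have rank_index i : a i = a (nth i0 s (index i s)) by rewrite nth_index.
have idx_lt i : (index i s < n)%N by rewrite -[X in (_ < X)%N]szs index_mem.
exists [set j in drop r s]%SET; first split.
- rewrite cardsE (card_uniqP _) ?drop_uniq //.
  by rewrite size_drop szs.
- by move=> i; rewrite memT => ri; rewrite rankE // -/(a i) (rank_index i) anti.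
- move=> i; rewrite memT -ltnNge => ri.
  by rewrite rankE // -/(a i) (rank_index i) anti // ltnW.
move=> phi; rewrite /trimmed_obj big_add1 /=.
rewrite (eq_bigl [in drop r s]); last by move=> i; rewrite inE.
rewrite -big_uniq ?drop_uniq //= (big_nth i0) size_drop szs.
rewrite -{1}[r]add0n big_addn; apply: eq_big_nat => k /andP[_ kr].
by rewrite nth_drop [(k + r)%N]addnC rankE // -ltn_subRL.
Qed.

(** Exchange argument: a bottom set T0 and T have equally many elements outside
    each other, and phi at the threshold |x|_{[r+1]} separates the values of
    phi on T0 \ T from those on T \ T0. *)
Lemma trimmed_obj_le_sum phi x r T :
    {in >= 0 &, {homo phi : s t / s <= t}} -> (r < n)%N -> #|T| = (n - r)%N ->
  trimmed_obj phi r x <= \sum_(i in T) phi `|x i 0|.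
Proof.
move=> phi_incr rn cT.
have [T0 [cT0 T0le T0ge] ->] := exists_bottom_set x rn.
have tau0 : 0 <= absrank x r.+1.
  have /card_gt0P[i iT0] : (0 < #|T0|)%N by rewrite cT0 subn_gt0.
  exact: le_trans (normr_ge0 _) (T0le i iT0).
rewrite (big_setID T) /= [leRHS](big_setID T0) /= finset.setIC lerD2l.
apply: (@le_trans _ _ (\sum_(i in T0 :\: T) phi (absrank x r.+1))).
  apply: ler_sum => i /setDP[iT0 _].
  by apply: phi_incr; rewrite ?nnegrE //; exact: T0le.
have -> : \sum_(i in T0 :\: T) phi (absrank x r.+1) =
          \sum_(i in T :\: T0) phi (absrank x r.+1).
  rewrite !sumr_const; congr (_ *+ _).
  by rewrite !cardsD finset.setIC cT cT0.
apply: ler_sum => i /setDP[_ iT0].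
by apply: phi_incr; rewrite ?nnegrE //; exact: T0ge.
Qed.

(** Being a bottom set can be tested without the threshold, by comparing entries
    pairwise; this is the form that survives a perturbation. An entry of T
    above the threshold would lie outside a genuine bottom set T0, and by
    cardinality T0 would have an element outside T, of smaller modulus; the
    other case is symmetric. *)
Lemma bottom_set_of_le x r T : (r < n)%N -> #|T| = (n - r)%N ->
  (forall i j, i \in T -> j \notin T -> `|x i 0| <= `|x j 0|) ->
  is_bottom_set x r T.
Proof.
move=> rn cT Tle; have [T0 [cT0 T0le T0ge] _] := exists_bottom_set x rn.
have exch (U V : {set 'I_n}) i : #|U| = #|V| -> i \in U -> i \notin V ->
    exists2 j, j \in V & j \notin U.
  move=> UV iU iV; apply/fintype.subsetPn; apply/negP => VU.
  have /eqP VE : V == U by rewrite eqEcard VU UV leqnn.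
  by rewrite VE iU in iV.
split=> // i iT; rewrite leNgt; apply/negP => lti.
- have iT0 : i \notin T0 by apply/negP => /T0le; rewrite leNgt lti.
  have [j jT0 jT] := exch T T0 i (etrans cT (esym cT0)) iT iT0.
  have := le_lt_trans (le_trans (Tle i j iT jT) (T0le j jT0)) lti.
  by rewrite ltxx.
- have iT0 : i \in T0 by apply/negPn/negP => /T0ge; rewrite leNgt lti.
  have [j jT jT0] := exch T0 T i (etrans cT0 (esym cT)) iT0 iT.
  have := lt_le_trans lti (le_trans (T0ge j jT0) (Tle j i jT iT)).
  by rewrite ltxx.
Qed.

(** Each strict inequality |x_i| < |x_j| persists near x, so a weak inequality
    between moduli of a nearby y holds for x as well. The converse fails: ties
    of x may be broken in y. *)
Lemma near_bottom_set x r : (r < n)%N ->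
  \forall y \near x, forall T, is_bottom_set y r T -> is_bottom_set x r T.
Proof.
move=> rn.
have absc i : continuous (fun y : 'cV[R]_n => `|y i 0|).
  move=> z; apply: (@continuous_comp _ _ _ (fun y : 'cV[R]_n => y i 0)).
    exact: coord_continuous.
  exact: norm_continuous.
have order_near i j : \forall y \near x,
    `|x i 0| < `|x j 0| -> `|(y : 'cV[R]_n) i 0| < `|y j 0|.
  have [ltij|_] := boolP (`|x i 0| < `|x j 0|); last by near=> y.
  have gap_cvg : (`|(y : 'cV[R]_n) j 0| - `|y i 0| @[y --> x] -->
      `|x j 0| - `|x i 0|)%classic.
    exact: cvgB (absc j x) (absc i x).
  near=> y => _; rewrite -subr_gt0; near: y.
  by apply: (cvgr_gt _ gap_cvg); rewrite subr_gt0.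
have all_order_near : \forall y \near x, forall i j : 'I_n,
    `|x i 0| < `|x j 0| -> `|(y : 'cV[R]_n) i 0| < `|y j 0|.
  exact: (filter_forall _ (fun i => filter_forall _ (order_near i))).
near=> y => T [cT Tle Tge]; apply: bottom_set_of_le => // i j iT jT.
have ynear : forall k l, `|x k 0| < `|x l 0| -> `|y k 0| < `|y l 0| by near: y.
rewrite leNgt; apply/negP => /ynear; apply/negP; rewrite -leNgt.
exact: le_trans (Tle i iT) (Tge j jT).
Unshelve. all: by end_near. Qed.

Lemma enorm_gt0 h : h != 0 -> 0 < enorm h.
Proof.
move=> h0; rewrite sqrtr_gt0 lt_def sumr_ge0 ?andbT; last first.
  by move=> i _; exact: sqr_ge0.
apply: contra h0 => /eqP/psumr_eq0P hE; apply/eqP/matrixP => i j.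
rewrite mxE ord1; apply/eqP; rewrite -sqrf_eq0.
by apply/eqP/hE => // k _; exact: sqr_ge0.
Qed.

(** Links the Euclidean ball of the null space property with the product
    topology in which local minimality is expressed. *)
Lemma near_enorm_lt x (e : R) : 0 < e -> \forall y \near x, enorm (y - x) < e.
Proof.
move=> e0.
have sq_cont : continuous (fun y : 'cV[R]_n =>
    \sum_(j < n) (y j 0 - x j 0) ^+ 2).
  apply: continuous_big => [|j _]; first exact: add_continuous.
  move=> z; apply: (@continuous_comp _ _ _
    (fun y : 'cV[R]_n => y j 0 - x j 0) (fun t : R => t ^+ 2)).
    exact: cvgB (@coord_continuous _ _ _ j 0 z) (cvg_cst _).
  exact: exprn_continuous.
have e20 : 0 < e ^+ 2 by rewrite exprn_gt0.
near=> y; rewrite /enorm.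
have -> : e = Num.sqrt (e ^+ 2) by rewrite sqrtr_sqr gtr0_norm.
rewrite ltr_sqrt //.
under eq_bigr do rewrite !mxE.
near: y; apply: (cvgr_lt _ (sq_cont x)).
by rewrite big1 // => j _; rewrite subrr expr0n.
Unshelve. all: by end_near. Qed.

(** If the threshold is positive, zeros lie strictly below it. If it is 0, then
    T consists of zeros only, and its n - r elements are at least as many as
    the n - ||x||_0 zeros, so T is the whole zero set. *)
Lemma idx_zero_sub_bottom_set x r T : (r <= l0norm x)%N -> (r < n)%N ->
  is_bottom_set x r T -> idx_zero x \subset T.
Proof.
move=> rl rn [cT Tle Tge].
have [tau_gt0|tau_le0] := ltP 0 (absrank x r.+1).
  apply/fintype.subsetP => i; rewrite inE => /eqP xi0.
  by apply/negPn/negP => /Tge; rewrite xi0 normr0 leNgt tau_gt0.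
have TI0 : T \subset idx_zero x.
  apply/fintype.subsetP => i /Tle xi.
  by rewrite inE -normr_le0; exact: le_trans tau_le0.
suff /eqP -> : T == idx_zero x by [].
have I0E : idx_zero x = ~: [set j | x j 0 != 0]%SET.
  by apply/finset.setP => j; rewrite !inE negbK.
by rewrite eqEcard TI0 cT I0E cardsCs finset.setCK card_ord leq_sub2l.
Qed.

(** The nonzero entries of T below the threshold are exactly I^{<+}, and the
    remaining ones equal the threshold; the cardinality of J is then forced by
    #|T| = n - r. *)
Lemma lnsp_family_bottom_set x r T : (r <= l0norm x)%N -> (r < n)%N ->
  is_bottom_set x r T ->
  exists2 J, J \in lnsp_family x r &
    J :|: idx_ltpos x r.+1 = T :\: idx_zero x.
Proof.
move=> rl rn Tb; have I0T := idx_zero_sub_bottom_set rl rn Tb.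
case: Tb => cT Tle Tge; set L := idx_ltpos x r.+1.
have LT : L \subset T :\: idx_zero x.
  apply/fintype.subsetP => i; rewrite !inE => /andP[xi_gt0 xi_lt].
  rewrite -normr_gt0 xi_gt0 /=.
  by apply/negPn/negP => /Tge; rewrite leNgt xi_lt.
exists ((T :\: idx_zero x) :\: L); last first.
  by rewrite finset.setUC -[L in L :|: _](finset.setIidPr LT) finset.setID.
rewrite inE; apply/andP; split.
  apply/fintype.subsetP => i.
  rewrite !inE -normr_gt0 => /and3P[xiL xi_gt0 /Tle xi].
  by move: xiL; rewrite xi_gt0 /= -leNgt eq_le xi.
have cLT := subset_leq_card LT; have cI0 := subset_leq_card I0T.
rewrite (cardsDS LT) -/L; rewrite (cardsDS I0T) cT in cLT *; rewrite cT in cI0.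
have : (#|idx_zero x| + l0norm x = n)%N.
  rewrite -[RHS]card_ord -(cardsC (idx_zero x)) /l0norm.
  by congr (_ + #|pred_of_set _|)%N; apply/finset.setP => j; rewrite !inE.
by move: cLT cI0 rl; lia.
Qed.

End TrimmedSums.

Theorem theorem4p1 (R : realType) (m n : nat) (A : 'M[R]_(m, n)) (b : 'cV[R]_m)
    (phi : R -> R) (xs : 'cV[R]_n) (r : nat)
    (phi_lsc : lower_semicontinuous
       (fun s : subspace [set s : R | 0 <= s]%classic => (phi s)%:E))
    (phi_incr : forall s t : R, 0 <= s -> s <= t -> phi s <= phi t)
    (phi0 : phi 0 = 0)
    (phi_tri : forall s t : R, 0 <= s -> 0 <= t ->
       phi s >= phi t - phi `|s - t|)
    (xs_sol : A *m xs = b)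
    (r_le_l0 : (r <= l0norm xs)%N)
    (r_lt_n : (r < n)%N)
    (xs_lnsp : lnsp A phi r xs) :
  strict_local_minimizer (trimmed_obj phi r)
    (fun x : 'cV[R]_n => A *m x - b = 0) xs.
Proof.
have [e e0 ns] := xs_lnsp.
split; first by rewrite xs_sol subrr.
near=> y => y_sol yx; pose h := y - xs.
have Ah : A *m h = 0 by rewrite mulmxBr xs_sol.
have h_small : 0 < enorm h < e.
  rewrite enorm_gt0 ?subr_eq0 //= /h; near: y; exact: near_enorm_lt.
have [T Ty fyE] := exists_bottom_set y r_lt_n.
have Tx : is_bottom_set xs r T.
  by move: T Ty {fyE}; near: y; exact: near_bottom_set.
have I0T := idx_zero_sub_bottom_set r_le_l0 r_lt_n Tx.
have [J JF JE] := lnsp_family_bottom_set r_le_l0 r_lt_n Tx.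
have phi_ge0 s : 0 <= s -> 0 <= phi s.
  by move=> s0; rewrite -phi0; exact: phi_incr.
have gap : \sum_(i in T :\: idx_zero xs) phi `|h i 0| <
    \sum_(i in idx_zero xs) phi `|h i 0|.
  apply: (le_lt_trans _ (_ : sup _ < _)); last first.
    by rewrite -subr_gt0; exact: ns.
  (* All terms are nonnegative, so the sum over every index bounds the family. *)
  apply: ub_le_sup; last by exists J; rewrite //= JE.
  exists (\sum_i phi `|h i 0|) => _ [K _ <-].
  rewrite [leRHS](bigID [in (K :|: idx_ltpos xs r.+1)%SET]) /= lerDl.
  by apply: sumr_ge0 => i _; exact: phi_ge0.
have fx_le : trimmed_obj phi r xs <=
    \sum_(i in T :\: idx_zero xs) phi `|xs i 0|.
  case: Tx => cT _ _.
  have phi_homo : {in >= 0 &, {homo phi : s t / s <= t}}.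
    by move=> s t; rewrite nnegrE => s0 _; exact: phi_incr.
  apply: le_trans (trimmed_obj_le_sum xs phi_homo r_lt_n cT) _.
  rewrite (big_setID (idx_zero xs)) /= big1 ?add0r // => i.
  by rewrite !inE => /andP[_ /eqP ->]; rewrite normr0.
rewrite fyE (big_setID (idx_zero xs)) /= (finset.setIidPr I0T).
have -> : \sum_(i in idx_zero xs) phi `|y i 0| =
          \sum_(i in idx_zero xs) phi `|h i 0|.
  by apply: eq_bigr => i; rewrite inE !mxE => /eqP ->; rewrite subr0.
apply: (le_lt_trans fx_le); rewrite -ltrBlDr -sumrB.
apply: le_lt_trans gap; apply: ler_sum => i _; rewrite lerBlDr -lerBlDl.
apply: le_trans (phi_tri `|y i 0| `|xs i 0| _ _) => //.
rewrite lerD2l lerN2; apply: phi_incr => //.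
by rewrite /h !mxE; exact: ler_dist_dist.
Unshelve. all: by end_near. Qed.
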